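(* Let $H$ be a real Hilbert space. Let $\Phi:H\to\mathbb R\cup\{+\infty\}$ be a closed convex proper function such that $C=\mathrm{argmin}\,\Phi\neq\emptyset$ and $\min_H\Phi=0$. Let $\Psi:H\to\mathbb R\cup\{+\infty\}$ be a closed convex proper function such that $\mathrm{argmin}_C\Psi\neq\emptyset$ and $\min_C\Psi=0$. Assume that the set $\mathrm{argmin}_C\Psi$ is bounded and that for every $R>0$ and $l\in\mathbb R$ the set $\{x\in H:\ \|x\|\le R,\ \Phi(x)+\Psi(x)\le l\}$ is relatively compact in $H$. Let $\varepsilon:[0,+\infty[\to\,]0,+\infty[$ be a map such that $\lim_{t\to+\infty}\varepsilon(t)=0$ and $\int_0^{+\infty}\varepsilon(t)\,dt=+\infty$. Let $x(\cdot)$ be a strong global solution of $$\dot x(t)+\partial\Phi(x(t))+\varepsilon(t)\,\partial\Psi(x(t))\ni0 .$$ Then: (i) $\lim_{t\to+\infty}d(x(t),\mathrm{argmin}_C\Psi)=0$. In particular, if $\mathrm{argmin}_C\Psi$ is a singleton $\{\overline x\}$ for some $\overline x\in H$, then $x(t)\to\overline x$ strongly in $H$ as $t\to+\infty$. (ii) If additionally $\int_0^{+\infty}|\omega(\varepsilon(t))|\,dt<+\infty$, where $\omega(\epsilon)=\inf_H(\Phi+\epsilon\Psi)$ for $\epsilon\ge0$, then there exists $x_\infty\in\mathrm{argmin}_C\Psi$ such that $x(t)\rightharpoonup x_\infty$ weakly in $H$ as $t\to+\infty$.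
   Context: $H$ is a real Hilbert space with scalar product $\langle\cdot,\cdot\rangle$ and norm $\|\cdot\|$; $d(x,S)=\inf_{z\in S}\|x-z\|$. ''Closed'' means lower semicontinuous; proper means not identically $+\infty$. $\mathrm{argmin}_C\Psi$ is the set of minimizers of $\Psi$ over $C$. The subdifferential is $\partial f(x)=\{p\in H: f(y)\ge f(x)+\langle p,y-x\rangle\ \forall y\in H\}$ for $x$ with $f(x)<+\infty$ (empty otherwise). A strong global solution is a function $x:[0,+\infty[\to H$, absolutely continuous on every bounded interval $[0,T]$, satisfying the inclusion for almost every $t>0$.
   Formalization: The map ε is additionally assumed Lebesgue integrable on every bounded interval [0,T]; without this, ∫ε could diverge only because of a singularity at a finite time (e.g. 1/t at 0), and then conclusion (i) can fail. *)

(* Defs.v *)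
From HB Require Import structures.
From mathcomp Require Import all_boot all_order all_algebra.
From mathcomp Require Import all_classical all_reals all_analysis.
Set Implicit Arguments.
Unset Strict Implicit.
Unset Printing Implicit Defensive.
Import Order.TTheory GRing.Theory Num.Theory.
Import numFieldNormedType.Exports.
Local Open Scope classical_set_scope.
Local Open Scope ring_scope.

(* MathComp-Analysis; functions into R u {+oo} are functions into \bar R that
   never take the value -oo (part of [closed_convex_proper]). *)

Definition econvex (R : realType) (H : normedModType R) (f : H -> \bar R) :=
  forall (x y : H) (t : R), 0 <= t <= 1 ->
    (f (t *: x + (1 - t) *: y)%R <= t%:E * f x + (1 - t)%:E * f y)%E.

Definition closed_convex_proper (R : realType) (H : normedModType R)
    (f : H -> \bar R) :=
  [/\ forall x, f x != -oo%E,
      lower_semicontinuous f,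
      econvex f
    & exists x, f x != +oo%E].

Definition argmin (R : realType) (T : Type) (D : set T) (f : T -> \bar R) :
    set T :=
  [set x | D x /\ forall y, D y -> (f x <= f y)%E].

Definition subdiff (R : realType) (H : normedModType R)
    (dot : {dot H for idfun}) (f : H -> \bar R) (x : H) : set H :=
  [set p | (f x < +oo)%E /\
           forall y, (f x + (dot p (y - x))%:E <= f y)%E].

(* Real [inf] is 0 on the empty set, so this is meaningful for S nonempty. *)
Definition dist_set (R : realType) (H : normedModType R) (x : H) (S : set H) :
    R :=
  inf [set `|x - z| | z in S].

Definition abs_continuous (R : realType) (H : normedModType R) (a b : R)
    (f : R -> H) :=
  forall e : R, 0 < e -> exists2 d : R, 0 < d &
    forall (n : nat) (s t : 'I_n -> R),
      (forall i, [/\ a <= s i, s i <= t i & t i <= b]) ->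
      trivIset setT (fun i => `]s i, t i[%classic) ->
      \sum_(i < n) (t i - s i) < d ->
      \sum_(i < n) `|f (t i) - f (s i)| < e.

(* Strong global solution of x' + subdiff Phi x + eps(t) subdiff Psi x \ni 0.
   Only the values x t with t >= 0 matter: differentiability is required at
   points t > 0 only. *)
Definition strong_solution (R : realType) (H : normedModType R)
    (dot : {dot H for idfun}) (Phi Psi : H -> \bar R) (eps : R -> R)
    (x : R -> H) :=
  (forall T : R, 0 <= T -> abs_continuous 0 T x) /\
  {ae @lebesgue_measure R, forall t : R, 0 < t ->
     derivable x t 1 /\
     exists p q : H, [/\ subdiff dot Phi (x t) p,
                         subdiff dot Psi (x t) q
                       & derive1 x t + p + eps t *: q = 0]}.

(* For e = 0 the convention 0 * +oo = 0 makes this the infimum of Phi. *)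
Definition omega (R : realType) (H : normedModType R) (Phi Psi : H -> \bar R)
    (e : R) : \bar R :=
  ereal_inf (range (fun y => Phi y + e%:E * Psi y)%E).

Definition weak_cvg (R : realType) (H : normedModType R) (x : R -> H)
    (l : H) :=
  forall f : {linear H -> R^o}, continuous f ->
    f (x t) @[t --> +oo] --> f l.

(* Main.v *)
Require Import Defs.
From HB Require Import structures.
From mathcomp Require Import all_boot all_order all_algebra.
From mathcomp Require Import all_classical all_reals all_analysis.
From mathcomp Require Import measurable_realfun ring lra.
Import Order.TTheory GRing.Theory Num.Theory.
Import numFieldNormedType.Exports.
Local Open Scope classical_set_scope.
Local Open Scope ring_scope.

Set Implicit Arguments.
Unset Strict Implicit.
Unset Printing Implicit Defensive.

(** The proof rests on one growth estimate and one one-dimensional comparison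
    principle.

    Let [S = argmin_C Psi], which is exactly the set where [Phi <= 0] and
    [Psi <= 0]; it is closed and lies in a compact sublevel set, hence it is
    compact. The subgradient inequalities at a time [t] give, for every [z] in
    [S], [<x'(t), x(t) - z> <= - (Phi + eps(t) Psi)(x(t))]
    ([strong_solution_descent]).

    The growth estimate ([penalty_ge_off_ball]): for every [delta > 0] there is
    [eta > 0] such that [Phi + e Psi >= e eta d(., S) / delta] wherever
    [d(., S) >= delta], as soon as [e < eta]. On the sphere [d(., S) = delta]
    this follows from compactness: along a violating sequence [Psi] is
    asymptotically nonpositive, so [Phi + Psi] stays bounded, and by lower
    semicontinuity a cluster point would lie in [S]. Convexity carries the
    bound from the sphere to its exterior, by contraction towards the
    projection on [S].

    The comparison principle ([abs_continuous_dini_le_integral]): an absolutely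
    continuous real function whose upper right Dini derivative is almost
    everywhere at most [g] increases by at most the integral of [g]. Dini
    derivatives are used because [d(x(t), S)] need not be differentiable, while
    its upper right derivative is controlled by that of [|x - z|] for a
    projection [z] of [x(t)].

    Together these make [d(x(t), S)] decrease at rate at least
    [(eta / delta) eps(t)] while it is at least [delta] and [t] is large. As
    [eps] has infinite integral, the distance falls below [delta], and then it
    stays there ([dist_set_eventually_le]). This is (i).

    For (ii), [Phi + eps Psi >= omega(eps)] shows that [|x - z|^2] increases by
    at most twice the integral of [|omega(eps)|], for every [z] in [S]. Since
    [d(x(t), S)] tends to 0 and [S] is compact, [x] has a strong cluster point
    [z] in [S]: [|x - z|^2] is small at arbitrarily late times, and from then on
    it can grow only by the tail of a convergent integral. So [x] even converges
    strongly to [z] ([strongly_convergent]). *)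

(** * Upper right Dini derivatives *)

(** The upper right Dini derivative of [f] at [t] is at most [c]. *)
Definition dini_le (R : realType) (f : R -> R) (t c : R) :=
  forall e : R, 0 < e -> exists2 r, 0 < r &
    forall s, t < s < t + r -> f s - f t <= (c + e) * (s - t).

Lemma dini_le_weaken (R : realType) (f : R -> R) (t c d : R) :
  c <= d -> dini_le f t c -> dini_le f t d.
Proof.
move=> cd fc e e0; have [r r0 fr] := fc e e0; exists r => // s ts.
by apply: le_trans (fr s ts) _; rewrite ler_wpM2r ?lerD2r//; lra.
Qed.

Lemma dini_leD (R : realType) (f g : R -> R) (t c d : R) :
  dini_le f t c -> dini_le g t d -> dini_le (fun s => f s + g s) t (c + d).
Proof.
move=> fc gd e e0; have e2 : 0 < e / 2 by rewrite divr_gt0.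
have [r r0 fr] := fc _ e2; have [r' r'0 gr] := gd _ e2.
exists (Num.min r r'); first by rewrite lt_min r0.
move=> s; rewrite -ltrBlDl lt_min !ltrBlDl => /and3P[ts sr sr'].
have := fr s ltac:(lra); have := gr s ltac:(lra).
by rewrite !(mulrDl, mulrBr); lra.
Qed.

(** Truncating [f] from below at [d] removes the times where [f] is below [d]
    from consideration: there an arbitrary finite Dini bound is enough, since
    it keeps [f] below [d] for a while. Hence a function which does not increase
    above the level [d] cannot cross it upwards. *)
Lemma dini_le_max0 (R : realType) (f : R -> R) (t c d : R) :
  dini_le f t c -> (d <= f t -> dini_le f t 0) ->
  dini_le (fun s => Num.max (f s) d) t 0.
Proof.
move=> fc f0 e e0; rewrite add0r; have [dft|ftd] := leP d (f t).
  have [r r0 fr] := f0 dft e e0; exists r => // s ts; have := fr s ts.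
  rewrite add0r lerBlDl => le.
  have es : 0 <= e * (s - t) by rewrite mulr_ge0 ?ltW//; lra.
  by rewrite lerBlDl ge_max le/=; lra.
have [r r0 fr] := fc 1 ltr01.
pose k := `|c| + 1; have k0 : 0 < k by rewrite ltr_wpDl.
exists (Num.min r ((d - f t) / k)).
  by rewrite lt_min r0 divr_gt0// subr_gt0.
move=> s; rewrite -ltrBlDl lt_min ltrBlDl => /and3P[ts sr].
rewrite ltr_pdivlMr// => sk.
have st : 0 < s - t by rewrite subr_gt0.
have := fr s ltac:(by rewrite ts sr) => le.
have ck : (c + 1) * (s - t) <= (s - t) * k.
  by rewrite mulrC ler_pM2l// lerD2r ler_norm.
have -> : Num.max (f s) d = d by apply/max_idPr; lra.
by rewrite subrr mulr_ge0// ltW.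
Qed.

Lemma derivable_right_expansion (R : realType) (V : normedModType R)
    (f : R -> V) (t : R) : derivable f t 1 ->
  forall e : R, 0 < e -> exists2 r, 0 < r &
    forall s, t < s < t + r ->
      `|f s - f t - (s - t) *: derive1 f t| <= e * (s - t).
Proof.
move=> df e e0; rewrite derive1E.
have /cvgrPdist_le/(_ _ e0) [r /= r0 fr] := df.
exists r => // s /andP[ts str]; set h := s - t.
have h0 : 0 < h by rewrite subr_gt0.
have := fr h; rewrite /ball/= sub0r normrN gtr0_norm//.
move=> /(_ ltac:(rewrite /h; lra) (lt0r_neq0 h0)).
rewrite [h%:A]mulr1 /h/= subrK -/h => le.
rewrite -[X in X - _](scalerKV (lt0r_neq0 h0)) -scalerBr normrZ gtr0_norm//.
rewrite mulrC ler_wpM2r ?(ltW h0)// distrC; exact: le.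
Qed.

Lemma derivable_dini_le (R : realType) (f : R -> R) (t : R) :
  derivable f t 1 -> dini_le f t (derive1 f t).
Proof.
move=> df e e0; have [r r0 fr] := derivable_right_expansion df e0.
exists r => // s ts; have := fr s ts; rewrite ler_norml => /andP[_].
by rewrite mulrDl lerBlDl [_ *: _]mulrC addrC.
Qed.

(** * Absolutely continuous functions *)

Lemma abs_continuous_dist (R : realType) (H : normedModType R) (a b : R)
    (f : R -> H) : abs_continuous a b f ->
  forall e : R, 0 < e -> exists2 d, 0 < d &
    forall s t, a <= s -> s <= t -> t <= b -> t - s < d -> `|f t - f s| < e.
Proof.
move=> acf e e0; have [d d0 fd] := acf e e0; exists d => // s t sa st tb std.
have := fd 1%N (fun=> s) (fun=> t).
rewrite !big_ord_recl !big_ord0 !addr0; apply=> //.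
by move=> i j _ _ _; rewrite (ord1 i) (ord1 j).
Qed.

(** Steps shorter than the modulus associated with 1 change [f] by less than 1,
    and boundedly many of them reach every point of [[a, b]]. *)
Lemma abs_continuous_bounded (R : realType) (V : normedModType R) (a b : R)
    (f : R -> V) : abs_continuous a b f ->
  exists M, forall t, a <= t <= b -> `|f t| <= M.
Proof.
move=> acf; have [d d0 fd] := abs_continuous_dist acf ltr01.
have step n t : a <= t <= b -> t - a <= n%:R * (d / 2) ->
    `|f t - f a| <= n%:R.
  elim: n t => [|n IH] t /andP[at_ tb].
    rewrite mul0r => ta; have -> : t = a by lra.
    by rewrite subrr normr0.
  rewrite -natr1 mulrDl mul1r => tn; pose s := Num.max a (t - d / 2).
  have as_ : a <= s by rewrite le_max lexx.
  have ts : t - d / 2 <= s by rewrite le_max lexx orbT.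
  have st : s <= t by rewrite ge_max at_/=; lra.
  have sn : s - a <= n%:R * (d / 2).
    rewrite lerBlDr ge_max lerDr mulr_ge0 ?ler0n//=; last by lra.
    by rewrite lerBlDr; lra.
  have := IH s ltac:(lra) sn; have := fd s t as_ st tb ltac:(lra).
  have := ler_distD (f s) (f t) (f a); lra.
exists (`|f a| + (Num.bound ((b - a) / (d / 2)))%:R) => t tab.
have d2 : 0 < d / 2 by lra.
have := step (Num.bound ((b - a) / (d / 2))) t tab.
rewrite -ler_pdivrMr// => /(_ _)/wrap[].
  have ba : 0 <= (b - a) / (d / 2) by rewrite divr_ge0//; lra.
  apply: le_trans (ltW (archi_boundP ba)); rewrite ler_pM2r ?invr_gt0//; lra.
move=> le; rewrite -(subrK (f a) (f t)) addrC.
by apply: le_trans (ler_normD _ _) _; rewrite lerD2l.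
Qed.

Lemma abs_continuousD (R : realType) (V : normedModType R) (a b : R)
    (f g : R -> V) : abs_continuous a b f -> abs_continuous a b g ->
  abs_continuous a b (fun t => f t + g t).
Proof.
move=> acf acg e e0.
have e2 : 0 < e / 2 by rewrite divr_gt0.
have [d d0 fd] := acf _ e2; have [d' d'0 gd] := acg _ e2.
exists (Num.min d d'); first by rewrite lt_min d0.
move=> n s t st tr; rewrite lt_min => /andP[ld ld'].
apply: (@le_lt_trans _ _ (\sum_(i < n) `|f (t i) - f (s i)| +
                          \sum_(i < n) `|g (t i) - g (s i)|)).
  rewrite -big_split/=; apply: ler_sum => i _.
  by rewrite opprD addrACA ler_normD.
by rewrite (splitr e) ltrD ?fd ?gd.
Qed.

(** This covers compositions with Lipschitz maps, such as the distance to a set,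
    as well as products with bounded factors. *)
Lemma abs_continuous_lipschitz (R : realType) (V W : normedModType R)
    (a b k : R) (f : R -> V) (g : R -> W) :
  (forall s t, a <= s -> s <= t -> t <= b ->
    `|g t - g s| <= k * `|f t - f s|) ->
  abs_continuous a b f -> abs_continuous a b g.
Proof.
move=> lip acf e e0; pose k' := Num.max k 1.
have k0 : 0 < k' by rewrite lt_max ltr01 orbT.
have [d d0 fd] := acf _ (divr_gt0 e0 k0); exists d => // n s t st tr ld.
apply: (@le_lt_trans _ _ (k' * \sum_(i < n) `|f (t i) - f (s i)|)).
  rewrite mulr_sumr; apply: ler_sum => i _; have [? ? ?] := st i.
  by apply: le_trans (lip _ _ _ _ _) _ => //; rewrite ler_wpM2r// le_max lexx.
by rewrite mulrC -ltr_pdivlMr// fd.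
Qed.

Lemma sum_length_le_measure (R : realType) (n : nat) (s u : 'I_n -> R)
    (U : set R) :
  measurable U -> (forall i, s i <= u i) ->
  (forall i, `]s i, u i[ `<=` U) ->
  trivIset setT (fun i => `]s i, u i[%classic) ->
  ((\sum_(i < n) (u i - s i))%:E <= @lebesgue_measure R U)%E.
Proof.
move=> mU su sub tr.
have -> : (\sum_(i < n) (u i - s i))%:E =
    (@lebesgue_measure R) (\big[setU/set0]_(i < n) `]s i, u i[%classic).
  rewrite measure_bigsetU_ord//= -sumEFin; apply: eq_bigr => i _.
  rewrite lebesgue_measure_itv/= lte_fin; case: ltP => // ui.
  by have /eqP -> : u i == s i; [rewrite eq_le ui su|rewrite subrr].
apply: le_measure; rewrite ?inE//.
  exact: bigsetU_measurable.
by apply: (big_ind (fun A => A `<=` U)) => // A B AU BU; rewrite subUset.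
Qed.

(** The absolute continuity of the integral with respect to the measure, applied
    to the union of the given intervals. *)
Lemma abs_continuous_primitive (R : realType) (g : R -> R) (a b : R) :
  (@lebesgue_measure R).-integrable setT (EFin \o g) ->
  abs_continuous a b
    (fun t : R => \int[@lebesgue_measure R]_(r in `]-oo, t]) g r).
Proof.
move=> ig e e0.
have [d [d0 gd]] := integral_normr_continuous ig e0.
exists d => // n s t st tr ld.
have mI i : measurable `]s i, t i[%classic by exact: measurable_itv.
pose D := \big[setU/set0]_(i <- enum 'I_n) `]s i, t i[%classic.
have mD : measurable D by apply: bigsetU_measurable.
have trD : trivIset [set` enum 'I_n] (fun i => `]s i, t i[%classic).
  by apply: sub_trivIset tr.
have DE : ((@lebesgue_measure R) D < d%:E)%E.
  rewrite /D big_enum/= measure_bigsetU_ord//.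
  move: ld; rewrite -(lte_fin _ d); apply: le_lt_trans.
  rewrite -sumEFin lee_sum => // i _.
  have [_ sti _] := st i; rewrite /= lebesgue_measure_itv/= lte_fin.
  by case: ltP => // ?; rewrite lee_fin subr_ge0.
have ing (A : set R) : measurable A ->
    (@lebesgue_measure R).-integrable A (EFin \o (fun r => `|g r|)).
  by move=> mA; apply: integrableS (integrable_norm ig).
apply: le_lt_trans (gd D mD DE).
have -> : \int[@lebesgue_measure R]_(r in D) `|g r| =
  \sum_(i < n) \int[@lebesgue_measure R]_(r in `]s i, t i[) `|g r|.
  rewrite /Rintegral integral_bigsetU_EFin//; [|exact: enum_uniq|].
    rewrite big_enum/= -sum_fine// => i _.
    by apply: integrable_fin_num => //; exact: ing.
  by apply: (measurable_int (@lebesgue_measure R)); exact: ing.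
apply: ler_sum => i _; have [_ sti _] := st i.
rewrite Rintegral_itvB ?bnd_simp//; last first.
  by apply: integrableS ig.
rewrite -Rintegral_itv_bndo_bndc; last by apply: integrableS ig.
by apply: le_normr_Rintegral => //; exact: integrableS ig.
Qed.

(** Away from a null set the Dini bound controls the increase of [f]. The null
    set is covered by an open set [U] of small measure, on which absolute
    continuity controls the total variation of [f] over any finite family of
    disjoint intervals. A continuous induction on [t] combines the two: the
    increase of [f] on [[a, t]] is at most [e (t - a)] plus the variation over
    such a family in [U]. *)
Lemma abs_continuous_dini_le0 (R : realType) (a b : R) (f : R -> R) :
  a <= b -> abs_continuous a b f ->
  {ae @lebesgue_measure R, forall t, a < t < b -> dini_le f t 0} ->
  f b <= f a.
Proof.
move=> ab acf [A [mA A0 subA]].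
suff main (e : R) : 0 < e -> f b - f a <= e * (b - a + 2).
  rewrite -subr_le0 leNgt; apply/negP => fba.
  have k0 : 0 < b - a + 2 by lra.
  have := main ((f b - f a) / 2 / (b - a + 2)).
  by rewrite divfK ?gt_eqF//; move=> /(_ ltac:(apply: divr_gt0 => //; lra)); lra.
move=> e0; have [d d0 fd] := acf e e0.
(* putting a itself in the exceptional set makes the first step one inside U *)
pose A' := A `|` [set a].
have mA' : measurable A' by apply: measurableU.
have A'0 : (@lebesgue_measure R) A' = 0%E.
  apply: (@measure_negligible _ _ _ (@lebesgue_measure R)) => //; apply: negligibleU.
    exact/negligibleP.
  by apply/negligibleP => //; exact: lebesgue_measure_set1.
have A'fin : (lebesgue_measure A' < +oo)%E by rewrite [X in (X < _)%E]A'0.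
have [U [oU A'U]] := lebesgue_regularity_outer mA' A'fin d0.
have mU : measurable U by exact: open_measurable.
have mUA : measurable (U `\` A') by exact: measurableD.
move=> Ud; have {}Ud : ((@lebesgue_measure R) U < d%:E)%E.
  rewrite -(setDUK A'U); apply: le_lt_trans Ud.
  rewrite -[leRHS]add0e -[X in (X + _)%E]A'0; exact: measureU2.
(* the arbitrarily small error h makes P closed under limits from the left,
   where finite families alone would not suffice *)
pose P t := forall h, 0 < h -> exists n (s u : 'I_n -> R),
  [/\ forall i, [/\ a <= s i, s i <= u i & u i <= t],
      forall i, `]s i, u i[ `<=` U,
      trivIset setT (fun i => `]s i, u i[%classic) &
      f t - f a <= e * (t - a) + \sum_(i < n) `|f (u i) - f (s i)| + h].
have PbP : P b -> f b - f a <= e * (b - a + 2).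
  move=> /(_ e e0) [n [s [u [su sub tr]]]].
  have : \sum_(i < n) `|f (u i) - f (s i)| < e.
    apply: fd => //.
    rewrite -lte_fin; apply: le_lt_trans Ud.
    by apply: sum_length_le_measure => // i; have [] := su i.
  lra.
pose E := [set t | [/\ a <= t, t <= b & P t]].
have Ea : E a.
  split => // h h0; exists 0%N, (fun=> a), (fun=> a).
  by split=> [[]//|[]//|[]//|]; rewrite big_ord0; lra.
have Eub : ubound E b by move=> t [].
have supE : has_sup E by split; [exists a|exists b].
pose c := sup E.
have ac : a <= c by apply: ub_le_sup; [exists b|].
have cb : c <= b by apply: ge_sup => //; exists a.
have Pc : P c.
  move=> h h0; have [r r0 fr] := abs_continuous_dist acf (divr_gt0 h0 (ltr0n _ 2)).
  have [t [at_ tb Pt] crt] := sup_adherent r0 supE.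
  have tc : t <= c by apply: ub_le_sup; [exists b|].
  have [n [s [u [su sub tr fle]]]] := Pt _ (divr_gt0 h0 (ltr0n _ 2)).
  exists n, s, u; split => //.
    by move=> i; have [? ? ?] := su i; split => //; lra.
  have := fr t c at_ tc cb ltac:(rewrite -/c in crt; lra).
  rewrite ltr_norml => /andP[_].
  have : 0 <= e * (c - t) by apply: mulr_ge0; lra.
  by rewrite !mulrBr in fle *; lra.
have stepP t : c < t -> t <= b -> P t -> False.
  move=> ct tb Pt; have : t <= c by apply: ub_le_sup; [exists b|split => //; lra].
  lra.
have [cb'|bc] := ltP c b; last first.
  by apply: PbP; have -> : b = c by apply: le_anti; rewrite bc cb.
exfalso.
have [Uc|Uc] := pselect (U c).
  (* a step inside U: add the interval [c, t] to the family *)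
  have [r /= r0 rU] : nbhs_ball c U by apply/nbhs_ballP; exact: open_nbhs_nbhs.
  pose t := Num.min b (c + r / 2).
  have ct : c < t by rewrite lt_min cb' /=; lra.
  have tb : t <= b by rewrite ge_min lexx.
  have tr2 : t <= c + r / 2 by rewrite ge_min lexx orbT.
  apply: (stepP t) => // h h0; have [n [s [u [su sub tr fle]]]] := Pc h h0.
  pose s' (i : 'I_n.+1) := if unlift ord0 i is Some j then s j else c.
  pose u' (i : 'I_n.+1) := if unlift ord0 i is Some j then u j else t.
  exists n.+1, s', u'; split.
  - move=> i; rewrite /s' /u'; case: unliftP => [j _|_]; last by split; lra.
    by have [? ? ?] := su j; split; lra.
  - move=> i; rewrite /s' /u'; case: unliftP => [j _|_]; first exact: sub.
    move=> y /=; rewrite in_itv/= => /andP[cy yt]; apply: rU.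
    by rewrite /ball/= ltr_norml; lra.
  - move=> i j _ _; rewrite /s' /u'.
    case: (unliftP ord0 i) => [i' ->|->]; case: (unliftP ord0 j) => [j' ->|->] //.
    + by move=> ne; have -> : i' = j' by exact: tr.
    + move=> [y /=]; rewrite !in_itv/= => -[]; have [] := su i'.
      by move=> _ _ uc /andP[_ yu] /andP[cy _]; exfalso; lra.
    + move=> [y /=]; rewrite !in_itv/= => -[]; have [] := su j'.
      by move=> _ _ uc /andP[cy _] /andP[_ yu]; exfalso; lra.
  - rewrite big_ord_recl /s' /u' unlift_none.
    under eq_bigr do rewrite liftK.
    have := ler_norm (f t - f c).
    have : 0 <= e * (t - c) by apply: mulr_ge0; lra.
    by rewrite !mulrBr in fle *; lra.
(* a step outside U: the Dini bound holds at c *)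
have ac' : a < c.
  rewrite lt_neqAle ac andbT; apply/eqP => aE; apply: Uc.
  by rewrite -aE; apply: A'U; right.
have Dc : dini_le f c 0.
  apply: contrapT => nD; apply: Uc; apply: A'U; left; apply: subA => /=.
  by move=> H; apply: nD; apply: H; rewrite ac'.
have [r r0 fr] := Dc e e0.
pose t := Num.min b (c + r / 2).
have ct : c < t by rewrite lt_min cb' /=; lra.
have tb : t <= b by rewrite ge_min lexx.
have tr2 : t <= c + r / 2 by rewrite ge_min lexx orbT.
apply: (stepP t) => // h h0; have [n [s [u [su sub tr fle]]]] := Pc h h0.
exists n, s, u; split => //.
  by move=> i; have [? ? ?] := su i; split => //; lra.
have := fr t ltac:(lra); rewrite add0r.
by rewrite !mulrBr in fle *; lra.
Qed.

(** Subtracting from [f] a primitive of [g], which has derivative [g] almost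
    everywhere by Lebesgue's differentiation theorem, reduces to the case of a
    nonpositive Dini derivative. *)
Lemma abs_continuous_dini_le_integral (R : realType) (a b : R) (f g : R -> R) :
  a <= b -> abs_continuous a b f ->
  (@lebesgue_measure R).-integrable `[a, b] (EFin \o g) ->
  {ae @lebesgue_measure R, forall t, a < t < b -> dini_le f t (g t)} ->
  f b - f a <= \int[@lebesgue_measure R]_(t in `[a, b]) g t.
Proof.
move=> ab acf ig dfg; pose h : R -> R := fun t => - (g \_ `[a, b]) t.
(* h is extended by 0 outside [a, b] so that its primitive is defined globally *)
have ih : (@lebesgue_measure R).-integrable setT (EFin \o h).
  rewrite (_ : EFin \o h = (-%E \o (EFin \o (g \_ `[a, b]))))%E//.
  by apply: integrableN => //; rewrite -restrict_EFin -integrable_mkcond.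
pose P t := \int[@lebesgue_measure R]_(r in `]-oo, t]) h r.
have Pint : P b - P a = - \int[@lebesgue_measure R]_(t in `[a, b]) g t.
  rewrite Rintegral_itvB ?bnd_simp//; last by apply: integrableS ih.
  rewrite Rintegral_itv_obnd_cbnd; last by apply: integrableS ih.
  rewrite -mulN1r -RintegralZl//; apply: eq_Rintegral => t tab.
  by rewrite mulN1r /h patchE tab.
suff : f b + P b <= f a + P a by lra.
apply: (@abs_continuous_dini_le0 R a b (fun t => f t + P t)) => //.
  by apply: abs_continuousD => //; exact: abs_continuous_primitive.
have locP : locally_integrable setT h.
  by apply: open_integrable_locally => //; exact: openT.
have iy y : (@lebesgue_measure R).-integrable `]-oo, y] (EFin \o h).
  by apply: integrableS ih.
have := FTC1Ny iy locP.
move: dfg; apply: (@filterS2 _ _ (ae_filter_ringOfSetsType _)) => t dfg [dP Pt] tab.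
rewrite -(subrr (g t)); apply: dini_leD; first exact: dfg.
have -> : - g t = derive1 P t.
  rewrite Pt /h patchE mem_set//= in_itv/=.
  by move: tab => /andP[/ltW -> /ltW ->].
exact: derivable_dini_le.
Qed.

(** * Integrals over the half-line *)

Lemma Rintegral_itv_chasles (R : realType) (f : R -> R) (a b c : R) :
  a <= b -> b <= c -> (@lebesgue_measure R).-integrable `[a, c] (EFin \o f) ->
  \int[@lebesgue_measure R]_(t in `[a, c]) f t =
  \int[@lebesgue_measure R]_(t in `[a, b]) f t +
  \int[@lebesgue_measure R]_(t in `[b, c]) f t.
Proof.
move=> ab bc fi; rewrite -[X in _ = _ + X]Rintegral_itv_obnd_cbnd; last first.
  by apply: integrableS fi => //; apply: subset_itv; rewrite bnd_simp.
by rewrite -(@Rintegral_itvB _ _ (BLeft a) (BRight c))// ?bnd_simp// addrC subrK.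
Qed.

Lemma integral_itv0y_cvg (R : realType) (f : R -> \bar R) :
  (forall t, 0 <= t -> (0 <= f t)%E) ->
  (forall n : nat, measurable_fun `[0%R, n%:R : R]%classic f) ->
  (\int[@lebesgue_measure R]_(t in `[0%R, n%:R : R]) f t)%E @[n --> \oo] -->
  (\int[@lebesgue_measure R]_(t in `[0%R, +oo[) f t)%E.
Proof.
move=> f0 mf; rewrite itv_bndy_bigcup_BRight.
have -> : (fun n : nat => `[0, 0 + n%:R]%classic) =
    (fun n : nat => `[0, n%:R : R]%classic).
  by apply/funext => n; rewrite add0r.
apply: ge0_nondecreasing_set_cvg_integral => //.
- move=> m n mn; rewrite subsetEset; apply: subset_itvl.
  by rewrite bnd_simp ler_nat.
- by move=> n t /=; rewrite in_itv/= => /andP[t0 _]; exact: f0.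
Qed.

(** The integral over a far away window is at most the gap between the integrals
    over initial segments and their supremum. *)
Lemma Rintegral_tail_le (R : realType) (g : R -> R) (B : R) :
  (forall t, 0 <= t -> 0 <= g t) ->
  (forall T, 0 <= T ->
    (@lebesgue_measure R).-integrable `[0, T] (EFin \o g)) ->
  (forall T, 0 <= T -> \int[@lebesgue_measure R]_(t in `[0, T]) g t <= B) ->
  forall e : R, 0 < e -> exists2 N, 0 <= N & forall s t, N <= s -> s <= t ->
    \int[@lebesgue_measure R]_(r in `[s, t]) g r <= e.
Proof.
move=> g0 ig gB e e0.
pose I T := \int[@lebesgue_measure R]_(t in `[0, T]) g t.
pose E := [set I T | T in [set T | 0 <= T]].
have supE : has_sup E.
  by split; [exists (I 0), 0 => /=|exists B => _ [T T0 <-]; exact: gB].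
have [_ [N N0 <-] IN] := sup_adherent e0 supE.
exists N => // s t Ns st.
have s0 : 0 <= s by exact: le_trans Ns.
have t0 : 0 <= t by exact: le_trans st.
have It : I t <= sup E by apply: sup_upper_bound => //; exists t.
have Ist := Rintegral_itv_chasles s0 st (ig t t0).
have INs := Rintegral_itv_chasles N0 Ns (ig s s0).
have : 0 <= \int[@lebesgue_measure R]_(r in `[N, s]) g r.
  apply: Rintegral_ge0 => r /=; rewrite in_itv/= => /andP[Nr _].
  by apply: g0; exact: le_trans Nr.
by move: It IN; rewrite /I Ist INs; lra.
Qed.

(** * The inner product and the distance to a set *)

Section inner_product.
Context (R : realType) (H : normedModType R) (dot : {dot H for idfun}).
Hypothesis dot_norm : forall u : H, dot u u = `|u| ^+ 2.

Lemma dotC (u v : H) : dot u v = dot v u.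
Proof. by rewrite hermC expr0 mul1r. Qed.

Lemma sqr_normD (u v : H) :
  `|u + v| ^+ 2 = `|u| ^+ 2 + 2 * dot u v + `|v| ^+ 2.
Proof.
by rewrite -!dot_norm !(linearDl, linearDr)/= (dotC v u); ring.
Qed.

(** Cauchy-Schwarz, from the nonnegativity of [| |v| u - |u| v |^2]. *)
Lemma dot_le_norm (u v : H) : dot u v <= `|u| * `|v|.
Proof.
have [->|u0] := eqVneq u 0; first by rewrite linear0l normr0 mul0r.
have [->|v0] := eqVneq v 0; first by rewrite linear0r normr0 mulr0.
have ab0 : 0 < `|u| * `|v| by rewrite mulr_gt0 ?normr_gt0.
rewrite -(ler_pM2l ab0); set a := `|u|; set b := `|v|.
have := sqr_ge0 `|b *: u - a *: v|.
rewrite sqr_normD normrN !normrZ !normr_id linearNr linearZl_LR linearZr_LR/=.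
rewrite -/a -/b => ?; lra.
Qed.

(** With [v] the derivative, [w = x t - z] and [q = x s - x t], expand
    [|w + q|^2]. The error of the first-order expansion, multiplied by [|w|],
    and the quadratic term [|q|^2] each receive half of the allowed slope
    [e]. *)
Lemma dini_le_sqr_dist (x : R -> H) (z : H) (t : R) : derivable x t 1 ->
  dini_le (fun s => `|x s - z| ^+ 2) t (2 * dot (derive1 x t) (x t - z)).
Proof.
move=> dx e e0; set v := derive1 x t; set w := x t - z.
pose k := e / (4 * (`|w| + 1)); have w0 : 0 <= `|w| by [].
have k0 : 0 < k by rewrite divr_gt0// mulr_gt0//; lra.
have kw : 2 * (k * `|w|) <= e / 2.
  have -> : e / 2 = 2 * (k * (`|w| + 1)) by rewrite /k; field; lra.
  by rewrite ler_pM2l// ler_pM2l//; lra.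
have [r r0 xr] := derivable_right_expansion dx k0.
pose m := (`|v| + k) ^+ 2; have m0 : 0 <= m by exact: sqr_ge0.
exists (Num.min r (e / 2 / (m + 1))).
  by rewrite lt_min r0/= !divr_gt0//; lra.
move=> s; rewrite -ltrBlDl lt_min ltrBlDl => /and3P[ts sr].
rewrite ltr_pdivlMr; last by lra.
set h := s - t => hm; have h0 : 0 < h by rewrite subr_gt0.
have {xr} := xr s ltac:(by rewrite ts sr).
rewrite -/v -/h; set q := x s - x t => qv.
have qE : `|q| <= (`|v| + k) * h.
  rewrite -(subrK (h *: v) q); apply: le_trans (ler_normD _ _) _.
  by rewrite normrZ (gtr0_norm h0); lra.
have qq : `|q| ^+ 2 <= m * h * h.
  have -> : m * h * h = ((`|v| + k) * h) ^+ 2 by rewrite /m; ring.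
  by rewrite expr2 [leRHS]expr2; apply: ler_pM.
have dq : dot q w <= h * dot v w + k * h * `|w|.
  rewrite -{1}(subrK (h *: v) q) linearDl linearZl_LR/= addrC lerD2l.
  by apply: le_trans (dot_le_norm _ _) _; rewrite ler_wpM2r.
have -> : x s - z = w + q by rewrite [w + q]addrC addrA subrK.
rewrite sqr_normD dotC.
have : m * h * h <= e / 2 * h by rewrite ler_pM2r//; nra.
have : 2 * (k * `|w|) * h <= e / 2 * h by rewrite ler_pM2r.
nra.
Qed.

End inner_product.

Section distance.
Context (R : realType) (H : normedModType R).
Implicit Types (x y z : H) (S : set H).

Lemma has_lbound_dist x S : has_lbound [set `|x - z| | z in S].
Proof. by exists 0 => _ [z _ <-]. Qed.

Lemma dist_set_le x z S : S z -> dist_set x S <= `|x - z|.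
Proof. by move=> Sz; apply: ge_inf; [exact: has_lbound_dist|exists z]. Qed.

Lemma dist_set_ge0 x S : S !=set0 -> 0 <= dist_set x S.
Proof.
move=> [z Sz]; apply: lb_le_inf; first by exists `|x - z|, z.
by move=> _ [y _ <-].
Qed.

Lemma dist_set_triangle x y S : S !=set0 ->
  dist_set x S <= `|x - y| + dist_set y S.
Proof.
move=> [z Sz]; rewrite -lerBlDl; apply: lb_le_inf; first by exists `|y - z|, z.
move=> _ [u Su <-]; rewrite lerBlDl.
by apply: le_trans (dist_set_le x Su) _; rewrite ler_distD.
Qed.

Lemma dist_set_lipschitz x y S : S !=set0 ->
  `|dist_set x S - dist_set y S| <= `|x - y|.
Proof.
move=> S0; rewrite ler_norml lerBlDr dist_set_triangle// andbT.
by rewrite lerNl opprB lerBlDr distrC dist_set_triangle.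
Qed.

Lemma dist_set_attained x S : S !=set0 -> compact S ->
  exists2 z, S z & dist_set x S = `|x - z|.
Proof.
move=> S0 cS.
have cd : {within S, continuous (fun z => `|x - z|)}.
  apply: continuous_subspaceT => z; apply: cvg_norm.
  by apply: cvgB; [exact: cvg_cst|exact: cvg_id].
have [z zS zmin] := compact_EVT_min S0 cS cd; rewrite inE in zS.
exists z => //; apply: le_anti; rewrite dist_set_le//=.
apply: lb_le_inf; first by exists `|x - z|, z.
by move=> _ [u Su <-]; apply: zmin; rewrite inE.
Qed.

End distance.

Section distance_dini.
Context (R : realType) (H : normedModType R) (dot : {dot H for idfun}).
Hypothesis dot_norm : forall u : H, dot u u = `|u| ^+ 2.
Variables (S : set H) (x : R -> H) (t : R).
Hypothesis dx : derivable x t 1.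

Lemma dini_le_dist_set_norm : S !=set0 ->
  dini_le (fun s => dist_set (x s) S) t `|derive1 x t|.
Proof.
move=> S0 e e0; have [r r0 xr] := derivable_right_expansion dx e0.
exists r => // s ts; have st : 0 < s - t by lra.
apply: le_trans (ler_norm _) _; apply: le_trans (dist_set_lipschitz _ _ S0) _.
rewrite -(subrK ((s - t) *: derive1 x t) (x s - x t)).
apply: le_trans (ler_normD _ _) _; rewrite normrZ (gtr0_norm st).
by have := xr s ts; lra.
Qed.

(** The distance to [S] is bounded by the distance to a fixed projection [z] of
    [x t], with equality at [t]. Moreover
    [d(t) (d(s) - d(t)) <= (d(s)^2 - d(t)^2) / 2], so the derivative of the
    square of the norm suffices and the norm need not be differentiated. *)
Lemma dini_le_dist_set (z : H) (c : R) :
  S z -> dist_set (x t) S = `|x t - z| -> 0 < dist_set (x t) S ->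
  dot (derive1 x t) (x t - z) <= c * dist_set (x t) S ->
  dini_le (fun s => dist_set (x s) S) t c.
Proof.
move=> Sz dz d0 dc e e0; set d := dist_set (x t) S.
have ed0 : 0 < 2 * (e * d) by rewrite !mulr_gt0.
have [r r0 xr] := dini_le_sqr_dist dot_norm z dx ed0.
exists r => // s ts; have st : 0 <= s - t by lra.
rewrite -(ler_pM2l d0) -/d.
have sz := dist_set_le (x s) Sz; have := xr s ts; rewrite -dz -/d => {}xr.
have sz2 : dist_set (x s) S ^+ 2 <= `|x s - z| ^+ 2.
  rewrite expr2 [leRHS]expr2; apply: ler_pM => //;
    by apply: dist_set_ge0; exists z.
have : (dist_set (x s) S - d) ^+ 2 >= 0 by exact: sqr_ge0.
have : dot (derive1 x t) (x t - z) * (s - t) <= c * d * (s - t).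
  by rewrite ler_wpM2r.
by rewrite !expr2 in sz2 xr *; lra.
Qed.

End distance_dini.

(** * Growth of the penalized function away from its constrained minimizers *)

Lemma argminP (R : realType) (T : Type) (D : set T) (f : T -> \bar R) :
  argmin D f = [set x | D x /\ (f x <= ereal_inf (f @` D))%E].
Proof.
apply/seteqP; split=> x [Dx fx]; split => //.
  by apply: le_ereal_inf_tmp => _ [y Dy <-]; exact: fx.
by move=> y Dy; apply: le_trans fx _; apply: ereal_inf_lbound; exists y.
Qed.

Section growth.
Context (R : realType) (H : normedModType R) (Phi Psi : H -> \bar R).
Hypothesis Phi_ge0 : forall y, (0 <= Phi y)%E.
Hypothesis Psi_ninfty : forall y, Psi y != -oo%E.
Hypothesis Phi_lsc : lower_semicontinuous Phi.
Hypothesis Psi_lsc : lower_semicontinuous Psi.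
Hypothesis Phi_cvx : econvex Phi.
Hypothesis Psi_cvx : econvex Psi.
(** When both minima vanish, this is [argmin (argmin setT Phi) Psi]. *)
Let S := [set y | (Phi y <= 0)%E /\ (Psi y <= 0)%E].
Hypothesis S_neq0 : S !=set0.
Hypothesis S_bounded : bounded_set S.
Hypothesis sublevel_compact : forall r l : R, 0 < r ->
  precompact [set y : H | `|y| <= r /\ (Phi y + Psi y <= l%:E)%E].

Let bound : exists2 r, 0 < r & forall z, S z -> `|z| <= r.
Proof.
have [M [Mreal SM]] := S_bounded.
exists (`|M| + 1); first by rewrite ltr_wpDl.
by apply: SM; apply: le_lt_trans (ler_norm M) _; rewrite ltrDl.
Qed.

Lemma compact_zeros : compact S.
Proof.
have [r r0 Sr] := bound.
have clS : closed S.
  have cl (f : H -> \bar R) : lower_semicontinuous f ->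
      closed [set y | (f y <= 0)%E].
    move=> /lower_semicontinuousP/(_ 0) fo.
    rewrite (_ : [set y | _] = ~` [set y | (0%:E < f y)%E]); first exact: open_closedC.
    by apply/seteqP; split => y /=; rewrite leNgt => /negP.
  by apply: closedI; exact: cl.
rewrite -(precompact_closed clS).
apply: precompact_subset (sublevel_compact 0 r0) => y Sy.
by split; [exact: Sr|have [? ?] := Sy; rewrite -[leRHS]adde0 leeD].
Qed.

(** If the bound fails with [eta = 1 / (n + 1)] for every [n], the witnesses
    [y n] satisfy [Psi (y n) < 1 / (n + 1)] because [Phi >= 0], and then
    [Phi (y n) + Psi (y n) <= 2], so that they cluster at some [p]. Lower
    semicontinuity gives [Psi p <= 0]. It also bounds [Psi] from below near [p],
    which forces [Phi (y n)] to be of the order of [e n], whence [Phi p <= 0].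
    Thus [p] is in [S], although the [y n] stay at distance [delta] from [S]. *)
Lemma penalty_ge_on_sphere (delta : R) : 0 < delta ->
  exists2 eta, 0 < eta & forall e y a b, 0 < e < eta ->
    Phi y = a%:E -> Psi y = b%:E -> dist_set y S = delta ->
    e * eta <= a + e * b.
Proof.
move=> delta0; apply: contrapT => nex.
have /choice[q qP] : forall n, exists q : R * H * R * R,
    let: (e, y, a, b) := q in
    [/\ 0 < e < n.+1%:R^-1, Phi y = a%:E, Psi y = b%:E,
        dist_set y S = delta & a + e * b < e * n.+1%:R^-1].
  move=> n; apply: contrapT => nq; apply: nex; exists n.+1%:R^-1 => //.
  move=> e y a b en ya yb yd; rewrite leNgt; apply/negP => lt.
  by apply: nq; exists (e, y, a, b).
pose e n := (q n).1.1.1; pose y n := (q n).1.1.2.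
pose a n := (q n).1.2; pose b n := (q n).2.
have {qP} qP n : [/\ 0 < e n < n.+1%:R^-1, Phi (y n) = (a n)%:E,
    Psi (y n) = (b n)%:E, dist_set (y n) S = delta &
    a n + e n * b n < e n * n.+1%:R^-1].
  by have := qP n; rewrite /e /y /a /b; case: (q n) => [[[]]].
have a0 n : 0 <= a n.
  by have [_ ya _ _ _] := qP n; rewrite -lee_fin -ya.
have inv1 n : n.+1%:R^-1 <= 1 :> R by rewrite invf_le1 ?ler1n.
have bn n : b n < n.+1%:R^-1.
  have [/andP[e0 _] _ _ _ lt] := qP n; rewrite -(ltr_pM2l e0).
  by apply: le_lt_trans lt; rewrite lerDr.
have [r r0 Sr] := bound.
have yr n : `|y n| <= r + delta.
  have [_ _ _ yd _] := qP n.
  have [z Sz] := dist_set_attained (y n) S_neq0 compact_zeros.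
  rewrite yd => zd; rewrite -(subrK z (y n)) addrC.
  by apply: le_trans (ler_normD _ _) _; rewrite -zd lerD2r Sr.
have := sublevel_compact 2 (addr_gt0 r0 delta0).
rewrite precompactE; set K := [set _ | _] => cK.
have yK n : K (y n).
  split; first exact: yr.
  have [/andP[e0 e1] -> -> _ lt] := qP n; rewrite -EFinD lee_fin.
  move: (inv1 n) (bn n) e1 lt; set k := n.+1%:R^-1 => k1 bk ek lt.
  (* a + b = (a + e b) + (1 - e) b, and both terms are at most 1 *)
  have : 0 <= (1 - e n) * (1 - b n) by apply: mulr_ge0; lra.
  have : e n * k <= e n * 1 by rewrite ler_pM2l.
  lra.
have [p [_ clp]] : closure K `&` cluster (y @ \oo) !=set0.
  by apply: cK; exists 0%N => // n _; exact/subset_closure/yK.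
(* the cluster point p is seen arbitrarily late and from any neighbourhood *)
have late (k : R) V : 0 < k -> nbhs p V -> exists2 n, n.+1%:R^-1 < k & V (y n).
  move=> k0 Vp.
  have [] := clp [set y n | n in [set n | n.+1%:R^-1 < k]] V _ Vp; last first.
    by move=> _ [[n nk <-] Vn]; exists n.
  have := near_infty_natSinv_lt (PosNum k0); apply: filterS => n nk.
  by exists n.
have Psip : (Psi p <= 0)%E.
  rewrite leNgt; apply/negP => Psi0.
  have [k k0 kp] : exists2 k : R, 0 < k & (k%:E < Psi p)%E.
    move: Psi0; case: (Psi p) => [s|_|//].
      by rewrite lte_fin => s0; exists (s / 2); rewrite ?lte_fin; lra.
    by exists 1; rewrite ?ltry.
  have [V Vp VPsi] := Psi_lsc kp; have [n nk Vn] := late k V k0 Vp.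
  have := VPsi _ Vn; have [_ _ -> _ _] := qP n; rewrite lte_fin => kb.
  by have := lt_trans (lt_trans kb (bn n)) nk; rewrite ltxx.
have [M M0 Mp] : exists2 M : R, 0 < M & ((- M)%:E < Psi p)%E.
  have := Psi_ninfty p; case: (Psi p) => [s _|_|//].
    exists (`|s| + 1); first by rewrite ltr_wpDl.
    by rewrite lte_fin; have := ler_norm (- s); rewrite normrN; lra.
  by exists 1; rewrite ?ltNyr ?ltry.
have Phip : (Phi p <= 0)%E.
  rewrite leNgt; apply/negP => Phi0.
  have [k k0 kp] : exists2 k : R, 0 < k & (k%:E < Phi p)%E.
    move: Phi0; case: (Phi p) => [s|_|//].
      by rewrite lte_fin => s0; exists (s / 2); rewrite ?lte_fin; lra.
    by exists 1; rewrite ?ltry.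
  have [V Vp VPhi] := Phi_lsc kp; have [W Wp WPsi] := Psi_lsc Mp.
  have M1 : 0 < 1 + M by rewrite addr_gt0.
  have [n nk [Vn Wn]] := late (k / (1 + M)) _ (divr_gt0 k0 M1) (filterI Vp Wp).
  have := VPhi _ Vn; have := WPsi _ Wn.
  have [/andP[e0 e1] -> -> _ lt] := qP n; rewrite !lte_fin => bM ka.
  move: (inv1 n) nk e1 lt; set i := n.+1%:R^-1 => i1 ik ei lt.
  have : e n * i <= e n * 1 by rewrite ler_pM2l.
  have : e n * (- M) < e n * b n by rewrite ltr_pM2l.
  have : e n * (1 + M) < k by rewrite -ltr_pdivlMr//; lra.
  lra.
have [n _ yn] := late 1 (ball p delta) ltr01 (nbhsx_ballx p delta delta0).
have [_ _ _ yd _] := qP n.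
have : dist_set (y n) S <= `|y n - p| by apply: dist_set_le; split.
by rewrite yd leNgt distrC; move: yn; rewrite -ball_normE /= => ->.
Qed.

(** Move [y] towards its projection [z] on [S] until the distance to [S] is
    [delta]. Since [Phi z <= 0] and [Psi z <= 0], convexity bounds the values
    at the new point by [delta / d] times those at [y]. *)
Lemma penalty_ge_off_ball (delta : R) : 0 < delta ->
  exists2 eta, 0 < eta & forall e y a b, 0 < e < eta ->
    Phi y = a%:E -> Psi y = b%:E -> delta <= dist_set y S ->
    e * eta * dist_set y S <= delta * (a + e * b).
Proof.
move=> delta0; have [eta eta0 sphere] := penalty_ge_on_sphere delta0.
exists eta => // e y a b ee ya yb; set d := dist_set y S => dd.
have d0 : 0 < d by exact: lt_le_trans dd.
have [z [Phiz Psiz]] := dist_set_attained y S_neq0 compact_zeros.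
rewrite -/d => dz.
pose s := delta / d; pose y' := s *: y + (1 - s) *: z.
have s01 : 0 <= s <= 1.
  by rewrite divr_ge0 ?(ltW delta0) ?(ltW d0)//= ler_pdivrMr// mul1r.
have below (f : H -> \bar R) (c : R) : econvex f -> f y' != -oo%E ->
    f y = c%:E -> (f z <= 0)%E -> exists2 c', f y' = c'%:E & c' <= s * c.
  move=> fcvx fy' yc fz; have := fcvx y z s s01; rewrite -/y' yc => fle.
  have {}fle : (f y' <= (s * c)%:E)%E.
    apply: le_trans fle _; rewrite EFinM -[leRHS]adde0 leeD//.
    by apply: mule_ge0_le0 => //; rewrite lee_fin; lra.
  move: fy' fle; case: (f y') => // c' _; rewrite lee_fin => c's.
  by exists c'.
have Phiy' : Phi y' != -oo%E by rewrite gt_eqF// (lt_le_trans (ltNyr 0)).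
have [a' ya' a's] := below Phi a Phi_cvx Phiy' ya Phiz.
have [b' yb' b's] := below Psi b Psi_cvx (Psi_ninfty _) yb Psiz.
have y'd : dist_set y' S = delta.
  have y'z : y' - z = s *: (y - z).
    by rewrite /y' scalerBl scale1r scalerBr addrA addrAC addrK.
  have yy' : y - y' = (1 - s) *: (y - z).
    by rewrite scalerBl scale1r -y'z opprB addrA subrK.
  have sd : s * d = delta by rewrite /s divfK ?gt_eqF.
  apply: le_anti; apply/andP; split.
    rewrite -sd dz -[s in leRHS]ger0_norm; last by case/andP: s01.
    by rewrite -normrZ -y'z; apply: dist_set_le.
  have := dist_set_triangle y y' S_neq0.
  by rewrite -/d yy' normrZ -dz ger0_norm; [rewrite -sd; lra|lra].
have := sphere e y' a' b' ee ya' yb' y'd.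
have /andP[e0 _] := ee => le.
have : e * b' <= e * (s * b) by rewrite ler_pM2l.
have -> : delta = s * d by rewrite /s divfK ?gt_eqF.
have : e * eta * d <= (a' + e * b') * d by rewrite ler_pM2r.
have : a' * d <= s * a * d by rewrite ler_pM2r.
move=> h1 h2 h3; have : e * b' * d <= e * (s * b) * d by rewrite ler_pM2r.
lra.
Qed.

End growth.

(** * The value function omega *)

Section omega.
Context (R : realType) (H : normedModType R) (Phi Psi : H -> \bar R).
Hypothesis Phi_ge0 : forall y, (0 <= Phi y)%E.
Hypothesis Psi_ninfty : forall y, Psi y != -oo%E.
Hypothesis S_neq0 : [set y | (Phi y <= 0)%E /\ (Psi y <= 0)%E] !=set0.

Lemma omega_le (e : R) (y : H) : (omega Phi Psi e <= Phi y + e%:E * Psi y)%E.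
Proof. by apply: ereal_inf_lbound; exists y. Qed.

Lemma omega_le0 (e : R) : 0 <= e -> (omega Phi Psi e <= 0)%E.
Proof.
move=> e0; have [z [Phiz Psiz]] := S_neq0; apply: le_trans (omega_le e z) _.
by rewrite -[leRHS]adde0 leeD// mule_ge0_le0.
Qed.

(** Where [Psi y >= 0] the penalized value is nonnegative, hence not below
    [omega], which is nonpositive; elsewhere it decreases as [e] grows. *)
Lemma omega_nonincreasing (e e' : R) : 0 <= e -> e <= e' ->
  (omega Phi Psi e' <= omega Phi Psi e)%E.
Proof.
move=> e0 ee'; apply: le_ereal_inf_tmp => _ [y _ <-].
have [Psi0|Psi0] := leP 0%E (Psi y).
  apply: le_trans (omega_le0 (le_trans e0 ee')) _.
  by rewrite adde_ge0// mule_ge0.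
apply: le_trans (omega_le e' y) _; rewrite leeD2l//.
have := Psi_ninfty y; move: Psi0; case: (Psi y) => // s.
by rewrite -!EFinM !lte_fin lee_fin => s0 _; rewrite ler_wnM2r// ltW.
Qed.

(** A monotone function is Borel measurable, its upper level sets being
    intervals. *)
Lemma measurable_omega (f : R -> R) (D : set R) : measurable D ->
  (forall t, D t -> 0 <= f t) -> measurable_fun D f ->
  measurable_fun D (fun t => omega Phi Psi (f t)).
Proof.
(* omega is monotone only on nonnegative arguments, hence the truncation *)
move=> mD f0 mf; pose w r := omega Phi Psi (Num.max r 0).
have mw : measurable_fun setT w.
  apply: (measurability _ (ErealGenOInfty.measurableE R)).
  move=> /= _ [_ [a ->]] <-; apply: measurableI => //.
  apply: is_interval_measurable => r s; rewrite !preimage_itvoy/= /w.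
  move=> _ ws u /andP[_ us]; apply: lt_le_trans ws _.
  apply: omega_nonincreasing; first by rewrite le_max lexx orbT.
  by rewrite ge_max !le_max us lexx orbT.
apply: (@eq_measurable_fun _ _ _ _ D (w \o f)); last exact: measurableT_comp.
by move=> t; rewrite inE => Dt; rewrite /w/=; congr omega; apply/max_idPl/f0.
Qed.

End omega.

(** * Trajectories *)

Section descent.
Context (R : realType) (H : normedModType R) (dot : {dot H for idfun}).
Variables (Phi Psi : H -> \bar R) (eps : R -> R) (x : R -> H).
Hypothesis dot_norm : forall u : H, dot u u = `|u| ^+ 2.
Let S := [set y | (Phi y <= 0)%E /\ (Psi y <= 0)%E].

Lemma subdiff_ineq (f : H -> \bar R) (y z p : H) (a : R) :
  subdiff dot f y p -> f y = a%:E -> (f z <= 0)%E -> dot p (z - y) <= - a.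
Proof.
move=> [_ /(_ z) sub] ya fz; have := le_trans sub fz.
by rewrite ya -EFinD lee_fin; lra.
Qed.

(** Add the subgradient inequalities for [Phi] and [eps t Psi] at [x t], tested
    at [z], where both functions are nonpositive. *)
Lemma strong_solution_descent :
  (forall y, Phi y != -oo%E) -> (forall y, Psi y != -oo%E) ->
  (forall t, 0 <= t -> 0 < eps t) -> strong_solution dot Phi Psi eps x ->
  {ae @lebesgue_measure R, forall t, 0 < t ->
    derivable x t 1 /\ exists a b,
    [/\ Phi (x t) = a%:E, Psi (x t) = b%:E &
        forall z, S z -> dot (derive1 x t) (x t - z) <= - (a + eps t * b)]}.
Proof.
move=> nPhi nPsi eps0 [_]; apply: (@filterS _ _ (ae_filter_ringOfSetsType _)).
move=> t sol t0; have [dx [p [q [pP qP pq]]]] := sol t0; split => //.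
have fin (f : H -> \bar R) y : (forall y, f y != -oo%E) -> (f y < +oo)%E ->
    exists a, f y = a%:E.
  by move=> /(_ y); case: (f y) => // r _ _; exists r.
have [a ya] := fin _ (x t) nPhi pP.1; have [b yb] := fin _ (x t) nPsi qP.1.
exists a, b; split => // z [Phiz Psiz].
have pz := subdiff_ineq pP ya Phiz; have qz := subdiff_ineq qP yb Psiz.
have -> : derive1 x t = - (p + eps t *: q).
  by apply/eqP; rewrite -addr_eq0 addrA pq.
rewrite -(opprB z) linearNl linearNr opprK linearDl linearZl_LR/=.
have : eps t * dot q (z - x t) <= eps t * - b.
  by rewrite ler_wpM2l// ltW// eps0// ltW.
lra.
Qed.

End descent.

Section distance_to_zero.
Context (R : realType) (H : normedModType R).
Variables (S : set H) (eps : R -> R) (x : R -> H).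
Hypothesis S_neq0 : S !=set0.
Hypothesis eps_ge0 : forall t, 0 <= t -> 0 <= eps t.
Hypothesis eps_loc : forall T : R, 0 <= T ->
  (@lebesgue_measure R).-integrable `[0, T] (EFin \o eps).
Hypothesis eps_int :
  (\int[@lebesgue_measure R]_(t in `[0%R, +oo[) (eps t)%:E = +oo)%E.
Hypothesis x_ac : forall T : R, 0 <= T -> abs_continuous 0 T x.
Variables (delta c T : R).
Hypothesis c_gt0 : 0 < c.
Hypothesis T_ge0 : 0 <= T.
Let d t := dist_set (x t) S.
Hypothesis d_dini : {ae @lebesgue_measure R, forall t, T < t ->
  (exists k, dini_le d t k) /\ (delta <= d t -> dini_le d t (- (c * eps t)))}.

Let d_ac (s t : R) : T <= s -> s <= t -> abs_continuous s t d.
Proof.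
move=> Ts st; have t0 : 0 <= t by exact: le_trans T_ge0 (le_trans Ts st).
apply: (@abs_continuous_lipschitz R H R s t 1 x d) => [u v _ _ _|].
  by rewrite mul1r dist_set_lipschitz.
move=> e e0; have [r r0 xr] := x_ac t0 e0; exists r => // n u v uv.
apply: xr => i; have [su ? ?] := uv i; split => //.
exact: le_trans T_ge0 (le_trans Ts su).
Qed.

(** Otherwise [d] would decrease forever at rate [c eps], and the integral of
    [eps] would be bounded by its value up to [T] plus [d T / c]. *)
Let enter : exists2 t : R, T <= t & d t <= delta.
Proof.
apply: contrapT => nenter.
have far (t : R) : T <= t -> delta < d t.
  by move=> Tt; rewrite ltNge; apply/negP => ?; apply: nenter; exists t.
pose I (t : R) := \int[@lebesgue_measure R]_(r in `[0, t]) eps r.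
have Ibound (t : R) : T <= t -> I t <= I T + d T / c.
  move=> Tt; have t0 : 0 <= t by exact: le_trans Tt.
  have iTt : (@lebesgue_measure R).-integrable `[T, t] (EFin \o eps).
    by apply: integrableS (eps_loc t0) => //; apply: subset_itvr; rewrite bnd_simp.
  have ige : (@lebesgue_measure R).-integrable `[T, t]
      (EFin \o (fun r => - c * eps r)).
    rewrite (_ : _ \o _ = fun r => ((- c)%:E * (EFin \o eps) r)%E)//.
    exact: integrableZl.
  have dd : {ae @lebesgue_measure R, forall r : R, T < r < t ->
      dini_le d r (- c * eps r)}.
    apply: (@filterS _ _ (ae_filter_ringOfSetsType _)) d_dini.
    move=> r dr /andP[Tr _]; have [_] := dr Tr; rewrite mulNr.
    by apply; apply/ltW/far/ltW.
  have := abs_continuous_dini_le_integral Tt (d_ac (lexx T) Tt) ige dd.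
  rewrite RintegralZl//.
  rewrite /I (Rintegral_itv_chasles T_ge0 Tt (eps_loc t0)) lerD2l.
  rewrite ler_pdivlMr//.
  have : 0 <= d t by apply: dist_set_ge0.
  lra.
have : (\int[@lebesgue_measure R]_(t in `[0%R, n%:R : R]) (eps t)%:E)%E
    @[n --> \oo] --> (+oo : \bar R)%E.
  rewrite -eps_int; apply: integral_itv0y_cvg => [t t0|n].
    by rewrite lee_fin eps_ge0.
  by apply: (measurable_int (@lebesgue_measure R)); exact: eps_loc.
move=> /cvgeyPgt /(_ (I T + d T / c)) near_gt.
have [N _ Nlarge] := filterI near_gt (nbhs_infty_ger T).
have [] := Nlarge N (leqnn N); rewrite /= => lt TN.
have := Ibound _ TN; rewrite leNgt => /negP; apply.
rewrite -lte_fin /I /Rintegral fineK//.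
by apply: integrable_fin_num => //; exact: eps_loc.
Qed.

(** Once [d] is at most [delta] it stays so, because [max d delta] has a
    nonpositive upper right derivative almost everywhere. *)
Lemma dist_set_eventually_le : exists2 t : R, T <= t &
  forall s : R, t <= s -> dist_set (x s) S <= delta.
Proof.
have [t Tt dt] := enter; exists t => // s ts.
have lip (p q : R) : `|Num.max p delta - Num.max q delta| <= `|p - q|.
  rewrite ler_norml; have := ler_norm (p - q); have := ler_norm (q - p).
  rewrite distrC; case: (leP p delta); case: (leP q delta); lra.
have mac : abs_continuous t s (fun r => Num.max (d r) delta).
  apply: (@abs_continuous_lipschitz R R R t s 1 d) (d_ac Tt ts) => u v _ _ _.
  rewrite mul1r; apply: le_trans (lip (d v) (d u)) _; exact: lexx.
have : Num.max (d s) delta <= Num.max (d t) delta.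
  apply: (abs_continuous_dini_le0 ts mac).
  apply: (@filterS _ _ (ae_filter_ringOfSetsType _)) d_dini.
  move=> r dr /andP[tr _]; have [[k dk] dc] := dr (le_lt_trans Tt tr).
  apply: dini_le_max0 dk _ => dd; apply: dini_le_weaken (dc dd).
  rewrite oppr_le0 mulr_ge0 ?(ltW c_gt0)// eps_ge0//.
  exact: le_trans T_ge0 (le_trans Tt (ltW tr)).
by rewrite (max_idPr dt) ge_max lexx andbT.
Qed.

End distance_to_zero.

Section strong_convergence.
Context (R : realType) (H : normedModType R).
Variables (S : set H) (g : R -> R) (x : R -> H) (B : R).
Hypothesis S_neq0 : S !=set0.
Hypothesis S_compact : compact S.
Hypothesis g_ge0 : forall t, 0 <= t -> 0 <= g t.
Hypothesis g_loc : forall T : R, 0 <= T ->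
  (@lebesgue_measure R).-integrable `[0, T] (EFin \o g).
Hypothesis g_bound : forall T : R, 0 <= T ->
  \int[@lebesgue_measure R]_(t in `[0, T]) g t <= B.
Hypothesis x_ac : forall T : R, 0 <= T -> abs_continuous 0 T x.
Hypothesis x_dini : {ae @lebesgue_measure R, forall t, 0 < t -> forall z, S z ->
  dini_le (fun s => `|x s - z| ^+ 2) t (2 * g t)}.
Hypothesis x_dist : dist_set (x t) S @[t --> +oo] --> (0 : R).

Lemma sqr_dist_increase (z : H) (s t : R) : S z -> 0 <= s -> s <= t ->
  `|x t - z| ^+ 2 - `|x s - z| ^+ 2 <=
  2 * \int[@lebesgue_measure R]_(r in `[s, t]) g r.
Proof.
move=> Sz s0 st; have t0 : 0 <= t by exact: le_trans st.
have [M xM] := abs_continuous_bounded (x_ac t0).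
have ig : (@lebesgue_measure R).-integrable `[s, t] (EFin \o g).
  by apply: integrableS (g_loc t0) => //; apply: subset_itvr; rewrite bnd_simp.
have i2g : (@lebesgue_measure R).-integrable `[s, t] (EFin \o (fun r => 2 * g r)).
  rewrite (_ : _ \o _ = fun r => ((2 : R)%:E * (EFin \o g) r)%E)//.
  exact: integrableZl.
rewrite -RintegralZl//.
apply: (@abs_continuous_dini_le_integral _ _ _ (fun s => `|x s - z| ^+ 2)) => //.
  apply: (@abs_continuous_lipschitz R H R s t (2 * (M + `|z|)) x) => [u v su uv vt|].
    have bd w : s <= w -> w <= t -> `|x w - z| <= M + `|z|.
      move=> sw wt; apply: le_trans (ler_normB _ _) _; rewrite lerD2r.
      by apply: xM; rewrite wt (le_trans s0 sw).
    rewrite subr_sqr normrM mulrC; apply: ler_pM => //.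
      apply: le_trans (ler_normD _ _) _; rewrite !normr_id mulr_natl mulr2n.
      by apply: lerD; apply: bd => //; [exact: le_trans uv|exact: le_trans vt].
    have -> : x v - x u = (x v - z) - (x u - z) by rewrite opprB addrA subrK.
    exact: ler_dist_dist.
  move=> e e0; have [r r0 xr] := x_ac t0 e0; exists r => // n u v uv.
  by apply: xr => i; have [su ? ?] := uv i; split => //; exact: le_trans su.
apply: (@filterS _ _ (ae_filter_ringOfSetsType _)) x_dini.
by move=> r xr /andP[sr _]; apply: xr => //; exact: le_lt_trans sr.
Qed.

(** Projections on [S] of late points of the trajectory cluster at some [z] in
    [S], and so does the trajectory, its distance to [S] being negligible. From
    a late time at which [|x t - z| <= e / 2], the square of this distance can
    grow by at most [e^2 / 2]. *)
Lemma strongly_convergent : exists2 z, S z & x t @[t --> +oo] --> z.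
Proof.
have /choice[p pP] : forall t, exists z, S z /\ dist_set (x t) S = `|x t - z|.
  by move=> t; have [z Sz zd] := dist_set_attained (x t) S_neq0 S_compact; exists z.
have [z [Sz clz]] : S `&` cluster (fmap p (pinfty_nbhs R)) !=set0.
  apply: S_compact; exists 0; split; first exact: num_real.
  by move=> t _; have [] := pP t.
exists z => //; apply/cvgrPdist_le => e e0.
have e4 : 0 < e / 4 by lra.
have e24 : 0 < e ^+ 2 / 4 by rewrite divr_gt0// exprn_gt0.
have [N N0 tail] := Rintegral_tail_le g_ge0 g_loc g_bound e24.
have /cvgrPdist_le/(_ _ e4) [N' [_ near_S]] := x_dist.
have [] := clz [set p t | t in [set t | Num.max N N' < t]] (ball z (e / 4)).
- exists (Num.max N N'); split; first exact: num_real.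
  by move=> t Nt; exists t.
- exact: nbhsx_ballx.
move=> _ [[t /= Nt <-]]; rewrite -ball_normE/= => zp.
move: Nt; rewrite gt_max => /andP[Nt N't].
exists t; split; first exact: num_real.
move=> s /ltW ts.
have xt : `|x t - z| <= e / 2.
  have := near_S _ N't; rewrite sub0r normrN ger0_norm; last exact: dist_set_ge0.
  have [_ ->] := pP t => xp; have := ler_distD (p t) (x t) z.
  by rewrite (distrC (p t) z); lra.
have xt2 : `|x t - z| ^+ 2 <= e ^+ 2 / 4.
  have -> : e ^+ 2 / 4 = (e / 2) * (e / 2) by field.
  by rewrite expr2; apply: ler_pM.
have t0 : 0 <= t by exact: le_trans (ltW Nt).
have := sqr_dist_increase Sz t0 ts; have := tail t s (ltW Nt) ts => It xs.
rewrite distrC -(@ler_pXn2r _ 2%N) ?nnegrE ?(ltW e0)//.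
by have : 0 < e ^+ 2 by [rewrite exprn_gt0]; lra.
Qed.

End strong_convergence.

Unset Implicit Arguments.

Theorem corollary3p5 (R : realType) (H : completeNormedModType R)
    (dot : {dot H for idfun})
    (dot_norm : forall u : H, dot u u = `|u| ^+ 2)
    (Phi Psi : H -> \bar R)
    (Phi_ccp : closed_convex_proper Phi)
    (C_neq0 : argmin setT Phi !=set0)
    (min_Phi : ereal_inf (range Phi) = 0%E)
    (Psi_ccp : closed_convex_proper Psi)
    (S_neq0 : argmin (argmin setT Phi) Psi !=set0)
    (min_Psi : ereal_inf (Psi @` argmin setT Phi) = 0%E)
    (S_bounded : bounded_set (argmin (argmin setT Phi) Psi))
    (sublevel_compact : forall r l : R, 0 < r ->
       precompact [set y : H | `|y| <= r /\ (Phi y + Psi y <= l%:E)%E])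
    (eps : R -> R)
    (eps_gt0 : forall t, 0 <= t -> 0 < eps t)
    (eps_loc : forall T : R, 0 <= T ->
       (@lebesgue_measure R).-integrable `[0, T]%classic (EFin \o eps))
    (eps_cvg0 : eps t @[t --> +oo] --> 0)
    (eps_int : (\int[@lebesgue_measure R]_(t in `[0%R, +oo[) (eps t)%:E
                = +oo)%E)
    (x : R -> H)
    (x_sol : strong_solution dot Phi Psi eps x) :
  [/\ dist_set (x t) (argmin (argmin setT Phi) Psi) @[t --> +oo] --> 0,
      forall xbar : H, argmin (argmin setT Phi) Psi = [set xbar] ->
        x t @[t --> +oo] --> xbar
    & (\int[@lebesgue_measure R]_(t in `[0%R, +oo[)
          `|omega Phi Psi (eps t)| < +oo)%E ->
      exists2 xinf : H, argmin (argmin setT Phi) Psi xinf & weak_cvg x xinf].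
Proof.
have [Phi_ninfty Phi_lsc Phi_cvx _] := Phi_ccp.
have [Psi_ninfty Psi_lsc Psi_cvx _] := Psi_ccp.
have Phi_ge0 y : (0 <= Phi y)%E.
  by rewrite -min_Phi; apply: ereal_inf_lbound; exists y.
have SE : argmin (argmin setT Phi) Psi =
    [set y | (Phi y <= 0)%E /\ (Psi y <= 0)%E].
  rewrite argminP min_Psi (argminP setT Phi) min_Phi.
  by apply/seteqP; split => y [] => [[_]|].
rewrite {}SE in S_neq0 S_bounded *; set S := [set y | _] in S_neq0 S_bounded *.
have S_compact : compact S by exact: compact_zeros S_bounded sublevel_compact.
have x_ac := x_sol.1.
have eps_ge0 (t : R) : 0 <= t -> 0 <= eps t by move=> /eps_gt0/ltW.
have desc := strong_solution_descent Phi_ninfty Psi_ninfty eps_gt0 x_sol.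
have dist_cvg : dist_set (x t) S @[t --> +oo] --> (0 : R).
  apply/cvgrPdist_le => delta delta0.
  have [eta eta0 growth] := penalty_ge_off_ball Phi_ge0 Psi_ninfty Phi_lsc
    Psi_lsc Phi_cvx Psi_cvx S_neq0 S_bounded sublevel_compact delta0.
  have /cvgrPdist_lt/(_ _ eta0) [M [_ epsM]] := eps_cvg0.
  pose T := Num.max 0 M.
  have T0 : 0 <= T by rewrite le_max lexx.
  have c0 : 0 < eta / delta by rewrite divr_gt0.
  have dini : {ae @lebesgue_measure R, forall t, T < t ->
      (exists k, dini_le (fun s => dist_set (x s) S) t k) /\
      (delta <= dist_set (x t) S ->
        dini_le (fun s => dist_set (x s) S) t (- (eta / delta * eps t)))}.
    apply: (@filterS _ _ (ae_filter_ringOfSetsType _)) desc => t.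
    move=> dt; rewrite gt_max => /andP[t0 Mt].
    have [dx [a [b [ya yb ab]]]] := dt t0.
    split; first by exists `|derive1 x t|; exact: dini_le_dist_set_norm.
    move=> dd; have [z Sz dz] := dist_set_attained (x t) S_neq0 S_compact.
    have d0 : 0 < dist_set (x t) S by exact: lt_le_trans dd.
    apply: (dini_le_dist_set dot_norm dx Sz dz d0).
    apply: le_trans (ab z Sz) _.
    have et0 := eps_gt0 t (ltW t0).
    have et : 0 < eps t < eta.
      by rewrite et0/=; have := epsM t Mt; rewrite sub0r normrN gtr0_norm.
    have := growth (eps t) (x t) a b et ya yb dd.
    rewrite -ler_pdivrMl// mulNr lerN2; apply: le_trans.
    by rewrite le_eqVlt; apply/orP; left; apply/eqP; field; rewrite gt_eqF.
  have [t Tt dt] := dist_set_eventually_le S_neq0 eps_ge0 eps_loc eps_int x_ac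
    c0 T0 dini.
  exists t; split; first exact: num_real.
  move=> s /ltW ts; rewrite sub0r normrN ger0_norm; last exact: dist_set_ge0.
  exact: dt.
split=> // [xbar Sxbar|omega_int].
  apply/cvgrPdist_le => e e0; have /cvgrPdist_le/(_ _ e0) := dist_cvg.
  apply: filterS => t; rewrite sub0r normrN.
  have [z Sz ->] := dist_set_attained (x t) S_neq0 S_compact.
  by move: Sz; rewrite Sxbar => ->; rewrite normr_id distrC.
(* g is real-valued as the comparison principle requires; omega (eps t) may be
   -oo, but only on a null set of times *)
pose w t := omega Phi Psi (eps t); pose g t := fine `|w t|%E.
have meps : measurable_fun `[(0 : R), +oo[ eps.
  rewrite itv_bndy_bigcup_BRight; apply/measurable_fun_bigcup => n.
    exact: measurable_itv.
  apply/measurable_EFinP; apply: (measurable_int (@lebesgue_measure R)).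
  by apply: eps_loc; rewrite add0r.
have mw : measurable_fun `[(0 : R), +oo[ w.
  apply: measurable_omega => // t; rewrite /= in_itv/= andbT.
  exact: eps_ge0.
have mabsw : measurable_fun `[(0 : R), +oo[ (fun t => `|w t|%E).
  by apply: measurableT_comp.
have iw : (@lebesgue_measure R).-integrable `[(0 : R), +oo[ w.
  by apply/integrableP.
have sub0 (T : R) : `[0, T] `<=` `[(0 : R), +oo[ by apply: subset_itvl.
have gw t : ((g t)%:E <= `|w t|)%E.
  by rewrite /g; case: (w t) => [r||]//=; rewrite leey.
have g0 (t : R) : 0 <= t -> 0 <= g t by move=> _; apply: fine_ge0.
have mg (T : R) : measurable_fun `[0, T] (EFin \o g).
  apply: measurableT_comp => //; apply: measurableT_comp => //.
  exact: measurable_funS mabsw.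
have g_le (T : R) : (\int[@lebesgue_measure R]_(t in `[0%R, T]) (g t)%:E <=
    \int[@lebesgue_measure R]_(t in `[0%R, +oo[) `|w t|)%E.
  apply: (@le_trans _ _ (\int[@lebesgue_measure R]_(t in `[0%R, T]) `|w t|)%E).
    apply: ge0_le_integral => //.
    - by move=> t _; rewrite lee_fin fine_ge0.
    - exact: mg.
    - exact: measurable_funS mabsw.
  exact: ge0_subset_integral.
have ig (T : R) : 0 <= T ->
    (@lebesgue_measure R).-integrable `[0, T] (EFin \o g).
  move=> T0; apply/integrableP; split; first exact: mg.
  apply: le_lt_trans omega_int; apply: le_trans (g_le T).
  rewrite le_eqVlt; apply/orP; left; apply/eqP; apply: eq_integral => t _.
  by rewrite /= ger0_norm// fine_ge0.
pose B := fine (\int[@lebesgue_measure R]_(t in `[0%R, +oo[) `|w t|)%E.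
have gB (T : R) : 0 <= T -> \int[@lebesgue_measure R]_(t in `[0, T]) g t <= B.
  move=> T0; apply: fine_le; last exact: g_le.
    by apply: integrable_fin_num => //; exact: ig.
  by rewrite ge0_fin_numE// integral_ge0.
have x_dini : {ae @lebesgue_measure R, forall t, 0 < t -> forall z, S z ->
    dini_le (fun s => `|x s - z| ^+ 2) t (2 * g t)}.
  have wfin : {ae @lebesgue_measure R, forall t : R,
      `[(0 : R), +oo[%classic t -> w t \is a fin_num}.
    by apply: integrable_ae iw.
  apply: (@filterS2 _ _ (ae_filter_ringOfSetsType _)) desc wfin.
  move=> t dt wt t0 z Sz; have [dx [a [b [ya yb ab]]]] := dt t0.
  apply: dini_le_weaken (dini_le_sqr_dist dot_norm z dx).
  rewrite ler_pM2l//; apply: le_trans (ab z Sz) _.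
  have {}wt : w t \is a fin_num by apply: wt; rewrite /= in_itv/= ltW.
  have := omega_le Phi Psi (eps t) (x t); rewrite -/(w t) ya yb -EFinM -EFinD.
  rewrite /g; move: wt; case: (w t) => // r _; rewrite lee_fin/= => rab.
  by have := ler_norm (- r); rewrite normrN; lra.
have [z Sz xz] := strongly_convergent S_neq0 S_compact g0 ig gB x_ac x_dini dist_cvg.
exists z => // f cf; exact: (continuous_cvg _ (cf z) xz).
Qed.
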